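(* Let $K,M,M_1>0$ be rational, $n\ge 1$, and $a\in(0,\frac{K}{M(1+nM_1)}]$ rational. Let $f:[-K,K]^n\to[-M,M]^n$ be a Lipschitz continuous vector field. Let $u\in \mathbf{I}[-K,K]^n\Rightarrow\mathbf{I}[-M,M]^n$ and $u'\in\mathbf{I}[-K,K]^n\Rightarrow\mathbf{I}[-M_1,M_1]^{n^2}$ be interval extensions of $f$ and of its $\overline{L}$-derivative $\overline{L}(f)$, respectively, with $(u,u')\in\mathcal{V}^1$, and assume $$\forall x\in\mathbf{I}[-K,K]^n:\quad \mathrm{w}(u(x))\le\|u'(x)\|_\infty\,\mathrm{w}(x).$$ If $u'$ is interval Lipschitz, then $E^2$ has second-order convergence, i.e. $\mathrm{w}\big(E^2_{(u,u')}(Q)\big)$ is $O(|Q|^2)$: there is a constant $C\ge0$ such that $\mathrm{w}\big(E^2_{(u,u')}(Q)\big)\le C|Q|^2$ for every $Q\in\mathcal{P}_{1,\mathbb{Q}}$.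
   Context: **Partitions.** A partition of $[0,a]$ is $Q=(q_0,\dots,q_k)$ with $k\ge1$, $0=q_0<\dots<q_k=a$; $|Q|=\max_i(q_i-q_{i-1})$; $\Delta_i=q_{i+1}-q_i$. $\mathcal{P}_{1,\mathbb{Q}}$ is the set of partitions of $[0,a]$ with rational points and $|Q|\le1$. **Interval notation.** For a box $R\subseteq\mathbb{R}^m$, $\mathbf{I}R$ is the set of non-empty compact boxes contained in $R$, ordered by reverse inclusion ($\alpha\sqsubseteq\beta\iff\beta\subseteq\alpha$), with Scott topology. $A\Rightarrow B$ is the domain of Scott-continuous maps, ordered pointwise. The width of an interval is $\mathrm{w}([\alpha,\beta])=\beta-\alpha$; the width of an interval vector or interval matrix is the maximum width of its entries; the width of a function is the supremum of the widths of its values. $\|[\alpha,\beta]\|=\max(|\alpha|,|\beta|)$, and for an interval matrix $\|A\|_\infty=\max_i\sum_j\|A_{ij}\|$. $\alpha\oplus r$ is the Minkowski sum $\alpha+[-r,r]^n$. All arithmetic is interval arithmetic and integrals are taken by integrating lower and upper bounds. **Derivatives and extensions.** For $h:[-K,K]^n\to\mathbb{R}$, $O$ relatively open and $b\subseteq\mathbb{R}^n$ a compact box (or $b=\mathbb{R}^n$), write $h\in\delta(O,b)$ if for all $x,y\in O$, $h(x)-h(y)\in\{\langle c,x-y\rangle: c\in b\}$. The $\overline{L}$-derivative is $\overline{L}(h)(x)=\bigcap\{b: x\in O,\ h\in\delta(O,b)\}$; for $h=(h_1,\dots,h_n)$, $\overline{L}(h)(x)$ is the $n\times n$ interval matrix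 with rows $\overline{L}(h_i)(x)$. $u$ is an interval extension of $f$ if $u(\{x\})=\{f(x)\}$ for all $x$; $u'$ is an interval extension of $\overline{L}(f)$ if $u'(\{x\})=\overline{L}(f)(x)$ for all $x$. The canonical interval extension $\boldsymbol{I}g$ of a (point- or set-valued) map $g$ sends a box $\alpha$ to the smallest box containing $\bigcup_{x\in\alpha}g(x)$. $\mathcal{V}^1$ is the set of pairs $(u,u')\in(\mathbf{I}[-K,K]^n\Rightarrow\mathbf{I}[-M,M]^n)\times(\mathbf{I}[-K,K]^n\Rightarrow\mathbf{I}[-M_1,M_1]^{n^2})$ for which there is $h:[-K,K]^n\to[-M,M]^n$ with $u\sqsubseteq\boldsymbol{I}h$ and $u'\sqsubseteq\boldsymbol{I}\overline{L}(h)$. $u'$ is interval Lipschitz if there is $L'\ge0$ with $\mathrm{w}(u'(\alpha))\le L'\,\mathrm{w}(\alpha)$ for all boxes $\alpha$ in its domain. **Operator $E^2$.** $y=E^2_{(u,u')}(Q):[0,a]\to\mathbf{I}[-K,K]^n$ is defined by $y(0)=(0,\dots,0)$ and, for $q_i<x\le q_{i+1}$, $$y(x)=y(q_i)+\int_{q_i}^x u(y(q_i))+(t-q_i)\,(u'\cdot u)\big(y(q_i)\oplus M\Delta_i\big)\,dt ,$$ where $(u'\cdot u)(\beta)$ is the product of the interval $n\times n$ matrix $u'(\beta)$ with the interval vector $u(\beta)$. *)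

(* Defs.v *)
From HB Require Import structures.
From mathcomp Require Import all_boot all_order all_algebra.
From mathcomp Require Import all_classical all_reals all_analysis.

Set Implicit Arguments.
Unset Strict Implicit.
Unset Printing Implicit Defensive.

Import Order.TTheory GRing.Theory Num.Theory.
Import numFieldNormedType.Exports.

Local Open Scope classical_set_scope.
Local Open Scope ring_scope.

(** * Scott topology on a subset [A] of [T] ordered by [le] *)

Definition directed (T : Type) (le : T -> T -> Prop) (S : set T) : Prop :=
  S !=set0 /\
  forall x y, S x -> S y -> exists z, [/\ S z, le x z & le y z].

Definition is_sup (T : Type) (le : T -> T -> Prop) (A S : set T) (s : T) : Prop :=
  [/\ A s, forall x, S x -> le x s
    & forall t, A t -> (forall x, S x -> le x t) -> le s t].

Definition scott_open (T : Type) (le : T -> T -> Prop) (A U : set T) : Prop :=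
  [/\ U `<=` A,
      forall x y, U x -> A y -> le x y -> U y
    & forall S s, S `<=` A -> directed le S -> is_sup le A S s -> U s ->
        S `&` U !=set0].

(** The domain [A => B].  A map on [A] is represented by a total function;
    nothing is required of, and nothing below depends on, its values outside
    [A]. *)
Definition scott_maps (T1 T2 : Type) (le1 : T1 -> T1 -> Prop)
    (le2 : T2 -> T2 -> Prop) (A : set T1) (B : set T2) : set (T1 -> T2) :=
  [set f | (forall x, A x -> B (f x)) /\
           forall V, scott_open le2 B V -> scott_open le1 A (A `&` f @^-1` V)].

(** * Boxes and interval arithmetic *)

(** A compact box of m x n matrices, given by its lower and upper corners;
    interval vectors are the case n = 1.  It denotes the empty set when some
    lower endpoint exceeds the upper one. *)
Record imx (R : realType) (m n : nat) := IMx {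
  lo : 'M[R]_(m, n);
  hi : 'M[R]_(m, n) }.

Definition points (R : realType) m n (b : imx R m n) : set 'M[R]_(m, n) :=
  [set v | forall i j, lo b i j <= v i j <= hi b i j].

Definition ipoint (R : realType) m n (v : 'M[R]_(m, n)) : imx R m n := IMx v v.

(** The box [-r, r]^(m x n). *)
Definition cube (R : realType) m n (r : R) : set 'M[R]_(m, n) :=
  [set v | forall i j, - r <= v i j <= r].
Arguments cube {R} m n r.

Definition boxes_in (R : realType) m n (B : set 'M[R]_(m, n)) : set (imx R m n) :=
  [set b | points b !=set0 /\ points b `<=` B].

(** The information order: reverse inclusion. *)
Definition ile (R : realType) m n (b c : imx R m n) : Prop :=
  points c `<=` points b.

(** I[-r,r]^(m x n) => I[-s,s]^(p x q). *)
Definition idom (R : realType) m n p q (r s : R) :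
    set (imx R m n -> imx R p q) :=
  scott_maps (@ile R m n) (@ile R p q)
    (boxes_in (cube m n r)) (boxes_in (cube p q s)).
Arguments idom {R} m n p q r s.

Definition width (R : realType) m n (b : imx R m n) : R :=
  \big[Num.max/0]_(p : 'I_m * 'I_n) (hi b p.1 p.2 - lo b p.1 p.2).

(** The width of a function on [D], as an extended real. *)
Definition fwidth (R : realType) m n (D : set R) (y : R -> imx R m n) : \bar R :=
  ereal_sup [set (width (y x))%:E | x in D].

(** The norm max_i sum_j max(|lo_ij|, |hi_ij|). *)
Definition inorm (R : realType) m n (b : imx R m n) : R :=
  \big[Num.max/0]_(i < m) \sum_(j < n) Num.max `|lo b i j| `|hi b i j|.

Definition iadd (R : realType) m n (b c : imx R m n) : imx R m n :=
  IMx (lo b + lo c) (hi b + hi c).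

(** The Minkowski sum b + [-r,r]^(m x n). *)
Definition ifat (R : realType) m n (b : imx R m n) (r : R) : imx R m n :=
  iadd b (IMx (const_mx (- r)) (const_mx r)).

Definition iscale (R : realType) m n (r : R) (b : imx R m n) : imx R m n :=
  IMx (\matrix_(i, j) Num.min (r * lo b i j) (r * hi b i j))
      (\matrix_(i, j) Num.max (r * lo b i j) (r * hi b i j)).

(** Endpoints of the product of intervals [a,b] * [c,d]. *)
Definition mul_lo (R : realType) (a b c d : R) : R :=
  Num.min (Num.min (a * c) (a * d)) (Num.min (b * c) (b * d)).
Definition mul_hi (R : realType) (a b c d : R) : R :=
  Num.max (Num.max (a * c) (a * d)) (Num.max (b * c) (b * d)).

Definition imul (R : realType) m n p (b : imx R m n) (c : imx R n p) :
    imx R m p :=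
  IMx (\matrix_(i, k) \sum_j mul_lo (lo b i j) (hi b i j) (lo c j k) (hi c j k))
      (\matrix_(i, k) \sum_j mul_hi (lo b i j) (hi b i j) (lo c j k) (hi c j k)).

Definition iint (R : realType) m n (s x : R) (F : R -> imx R m n) : imx R m n :=
  IMx (\matrix_(i, j)
         (\int[@lebesgue_measure R]_(t in `[s, x]) (lo (F t) i j))%R)
      (\matrix_(i, j)
         (\int[@lebesgue_measure R]_(t in `[s, x]) (hi (F t) i j))%R).

(** * The L-derivative and interval extensions *)

(** Compact boxes and the whole space. *)
Definition is_box (R : realType) m n (B : set 'M[R]_(m, n)) : Prop :=
  B = setT \/ exists b : imx R m n, B = points b.

Definition rel_open (R : realType) n (K : R) (O : set 'cV[R]_n) : Prop :=
  exists2 U : set 'cV[R]_n, open U & O = U `&` cube n 1 K.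

(** h \in delta(O, b).  Points are column vectors and the elements [c] of [b]
    are row vectors, so that <c, x - y> is the single entry of [c *m (x - y)]. *)
Definition tie (R : realType) n (h : 'cV[R]_n -> R)
    (O : set 'cV[R]_n) (b : set 'rV[R]_n) : Prop :=
  forall x y, O x -> O y ->
    [set (c *m (x - y)) 0 0 | c in b] (h x - h y).

(** L-derivative of h : [-K,K]^n -> R; only the values of [h] on the cube
    matter. *)
Definition Lderiv (R : realType) n (K : R) (h : 'cV[R]_n -> R)
    (x : 'cV[R]_n) : set 'rV[R]_n :=
  [set c | forall (O : set 'cV[R]_n) (b : set 'rV[R]_n),
      rel_open K O -> is_box b -> O x -> tie h O b -> b c].

(** The interval matrix with rows L(h_i)(x), as a set of matrices. *)
Definition Lderiv_mx (R : realType) n (K : R) (h : 'cV[R]_n -> 'cV[R]_n)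
    (x : 'cV[R]_n) : set 'M[R]_n :=
  [set A | forall i, Lderiv K (fun z => h z i 0) x (row i A)].

Definition box_hull (R : realType) m n (S : set 'M[R]_(m, n)) :
    set 'M[R]_(m, n) :=
  [set v | forall B, is_box B -> S `<=` B -> B v].

(** The canonical interval extension of a set-valued map. *)
Definition canon_ext (R : realType) m n p q
    (g : 'M[R]_(m, n) -> set 'M[R]_(p, q)) (a : imx R m n) :
    set 'M[R]_(p, q) :=
  box_hull (\bigcup_(x in points a) g x).

Definition interval_ext (R : realType) n (K : R) (f : 'cV[R]_n -> 'cV[R]_n)
    (u : imx R n 1 -> imx R n 1) : Prop :=
  forall x, cube n 1 K x -> u (ipoint x) = ipoint (f x).

Definition interval_ext_L (R : realType) n (K : R)
    (f : 'cV[R]_n -> 'cV[R]_n) (u' : imx R n 1 -> imx R n n) : Prop :=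
  forall x, cube n 1 K x -> points (u' (ipoint x)) = Lderiv_mx K f x.

Definition V1 (R : realType) n (K M M1 : R) :
    set ((imx R n 1 -> imx R n 1) * (imx R n 1 -> imx R n n)) :=
  [set uu | [/\ idom n 1 n 1 K M uu.1,
                idom n 1 n n K M1 uu.2
              & exists h : 'cV[R]_n -> 'cV[R]_n,
                [/\ forall x, cube n 1 K x -> cube n 1 M (h x),
                    forall a, boxes_in (cube n 1 K) a ->
                      canon_ext (fun x => [set h x]) a `<=` points (uu.1 a)
                  & forall a, boxes_in (cube n 1 K) a ->
                      canon_ext (Lderiv_mx K h) a `<=` points (uu.2 a)]]].
Arguments V1 {R} n K M M1.

Definition interval_lipschitz (R : realType) n (K : R)
    (u' : imx R n 1 -> imx R n n) : Prop :=
  exists2 L : R, 0 <= L &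
    forall a, boxes_in (cube n 1 K) a -> width (u' a) <= L * width a.

(** * Partitions and the operator E^2 *)

(** A partition (q_0, ..., q_k) of [0, a] is represented, as in
    [itv_partition], by the sequence s = (q_1, ..., q_k). *)
Definition pt (R : realType) (s : seq R) (i : nat) : R := (0 :: s)`_i.

Definition gap (R : realType) (s : seq R) (i : nat) : R := pt s i.+1 - pt s i.

Definition mesh (R : realType) (s : seq R) : R :=
  \big[Num.max/0]_(i < size s) gap s i.

Definition P1Q (R : realType) (a : R) : set (seq R) :=
  [set s | [/\ (1 <= size s)%N, itv_partition 0 a s,
               forall i, (i <= size s)%N -> rational (pt s i)
             & mesh s <= 1]].

(** The value at x, for q_i < x <= q_{i+1}, when y(q_i) = Y. *)
Definition E2_piece (R : realType) n (M : R) (u : imx R n 1 -> imx R n 1)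
    (u' : imx R n 1 -> imx R n n) (s : seq R) (i : nat) (Y : imx R n 1)
    (x : R) : imx R n 1 :=
  let beta := ifat Y (M * gap s i) in
  iadd Y (iint (pt s i) x (fun t =>
    iadd (u Y) (iscale (t - pt s i) (imul (u' beta) (u beta))))).

(** The values y(q_i). *)
Fixpoint E2_node (R : realType) n (M : R) (u : imx R n 1 -> imx R n 1)
    (u' : imx R n 1 -> imx R n n) (s : seq R) (i : nat) : imx R n 1 :=
  if i is j.+1
  then E2_piece M u u' s j (E2_node M u u' s j) (pt s j.+1)
  else ipoint 0.

(** For x > 0, [find] returns the index i with q_i < x <= q_{i+1}, since
    position i of s holds q_{i+1}; see [E2_eq] for the defining equation. *)
Definition E2 (R : realType) n (M : R) (u : imx R n 1 -> imx R n 1)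
    (u' : imx R n 1 -> imx R n n) (s : seq R) (x : R) : imx R n 1 :=
  if x <= 0 then ipoint 0
  else let i := find (fun q => x <= q) s in
       E2_piece M u u' s i (E2_node M u u' s i) x.

Lemma E2_0 (R : realType) n (M : R) (u : imx R n 1 -> imx R n 1)
    (u' : imx R n 1 -> imx R n n) (s : seq R) :
  E2 M u u' s 0 = ipoint 0.
Proof. by rewrite /E2 lexx. Qed.

Lemma find_pt (R : realType) (a : R) (s : seq R) (i : nat) (x : R) :
  itv_partition 0 a s -> (i < size s)%N -> pt s i < x <= pt s i.+1 ->
  find (fun q => x <= q) s = i.
Proof.
case=> + _; rewrite /pt.
suff gen q0 : path <%R q0 s -> (i < size s)%N ->
    (q0 :: s)`_i < x <= (q0 :: s)`_i.+1 -> find (fun q => x <= q) s = i.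
  exact: gen.
elim: s q0 i => [//|q s IH] q0 [|i] /= /andP[q0q qs] ilt /andP[hx xh].
  by rewrite xh.
have qx : q < x.
  apply: le_lt_trans hx; case: i ilt {xh} => [//|i] ilt /=.
  apply: ltW; move: qs; rewrite (path_sortedE lt_trans) => /andP[/allP h _].
  by apply: h; apply: mem_nth; apply: ltnW.
by rewrite leNgt qx /=; congr S; apply: (IH q) => //; rewrite hx xh.
Qed.

Lemma pt_ge0 (R : realType) (a : R) (s : seq R) (i : nat) :
  itv_partition 0 a s -> (i <= size s)%N -> 0 <= pt s i.
Proof.
rewrite /pt => -[+ _]; case: i => [//|i] /= ps ilt.
move: ps; rewrite (path_sortedE lt_trans) => /andP[/allP h _].
by apply: ltW; apply: h; apply: mem_nth.
Qed.

Lemma E2_eq (R : realType) n (M a : R) (u : imx R n 1 -> imx R n 1)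
    (u' : imx R n 1 -> imx R n n) (s : seq R) (i : nat) (x : R) :
  itv_partition 0 a s -> (i < size s)%N -> pt s i < x <= pt s i.+1 ->
  let y := E2 M u u' s in
  y x = iadd (y (pt s i)) (iint (pt s i) x (fun t =>
    iadd (u (y (pt s i)))
         (iscale (t - pt s i)
            (imul (u' (ifat (y (pt s i)) (M * gap s i)))
                  (u (ifat (y (pt s i)) (M * gap s i))))))).
Proof.
move=> Ps ilt hx y.
have yi : y (pt s i) = E2_node M u u' s i.
  rewrite /y; case: i ilt {hx} => [|i] ilt; first exact: E2_0.
  have lti : pt s i < pt s i.+1.
    by case: Ps => /pathP-/(_ 0) h _; apply: h; apply: ltnW.
  have p0 : 0 <= pt s i by apply: (pt_ge0 Ps); do 2 apply: ltnW.
  rewrite /E2 leNgt (le_lt_trans p0 lti) /=.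
  by rewrite (find_pt Ps (i := i)) ?lti ?lexx//; apply: ltnW.
have x0 : 0 < x.
  by apply: (le_lt_trans (pt_ge0 Ps (ltnW ilt))); case/andP: hx.
by rewrite yi /y /E2 leNgt x0 /= (find_pt Ps ilt hx).
Qed.

(* Main.v *)
(** With [w] the width of [y(q_i)], the hypotheses on [u] and [u'] bound the
    width of [u(y(q_i))] by [n M1 w] and that of [(u'.u)(beta)] by a constant
    times [w + 2 M Delta_i].  Integrating over a step of length [h] gives
    [w(y(q_i + h)) <= (1 + A h) w + B h |Q|^2], because the second-order term
    carries a factor [h^2].  A discrete Gronwall argument turns this into
    [w(y(x)) <= B |Q|^2 x exp (A x)].  The bound on [a] keeps every argument of
    [u] and [u'] inside the cube. *)
Require Import Defs.
From HB Require Import structures.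
From mathcomp Require Import all_boot all_order all_algebra.
From mathcomp Require Import all_classical all_reals all_analysis.
From mathcomp Require Import ring lra.

Set Implicit Arguments.
Unset Strict Implicit.
Unset Printing Implicit Defensive.

Import Order.TTheory GRing.Theory Num.Theory.
Import numFieldNormedType.Exports.

Local Open Scope classical_set_scope.
Local Open Scope ring_scope.

(** * Boxes as entrywise bounds, and their widths *)

(** Entrywise form of membership in [boxes_in (cube m n r)]: non-emptiness becomes the order of the
    endpoints, so everything is linear in the entries. *)
Definition box_within (R : realType) m n (b : imx R m n) (r : R) : Prop :=
  forall i j, [/\ - r <= lo b i j, lo b i j <= hi b i j & hi b i j <= r].

(** A non-empty box contains its two corners, and containment in the cube is read off there. *)
Lemma boxes_inP (R : realType) m n (b : imx R m n) (r : R) :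
  boxes_in (cube m n r) b <-> box_within b r.
Proof.
split=> [[[v bv] br] i j | br].
  have lh k l : lo b k l <= hi b k l.
    by case/andP: (bv k l) => /le_trans h /h.
  have blo : points b (lo b) by move=> k l; rewrite lexx lh.
  have bhi : points b (hi b) by move=> k l; rewrite lexx lh.
  by case/andP: (br _ blo i j) => ? _; case/andP: (br _ bhi i j).
split=> [|v bv i j].
  by exists (lo b) => i j; case: (br i j) => _ h _; rewrite lexx h.
case/andP: (bv i j) => h1 h2; case: (br i j) => h3 _ h4.
by rewrite (le_trans h3 h1) (le_trans h2 h4).
Qed.

Lemma box_within_le (R : realType) m n (b : imx R m n) (r s : R) :
  r <= s -> box_within b r -> box_within b s.
Proof. by move=> rs br i j; case: (br i j) => *; split=> //; lra. Qed.

Lemma width_leP (R : realType) m n (b : imx R m n) (w : R) : 0 <= w ->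
  (forall i j, hi b i j - lo b i j <= w) -> width b <= w.
Proof. by move=> w0 bw; apply: bigmax_le => // -[i j] _; apply: bw. Qed.

Lemma entry_width (R : realType) m n (b : imx R m n) i j :
  hi b i j - lo b i j <= width b.
Proof. exact: (le_bigmax _ (fun p => hi b p.1 p.2 - lo b p.1 p.2) (i, j)). Qed.

Lemma width_ge0 (R : realType) m n (b : imx R m n) : 0 <= width b.
Proof. exact: bigmax_ge_id. Qed.

Lemma width_ipoint (R : realType) m n (v : 'M[R]_(m, n)) :
  width (ipoint v) = 0.
Proof.
apply/le_anti; rewrite width_ge0 andbT.
by apply: width_leP => // i j; rewrite subrr.
Qed.

Lemma natr_mul_sum (R : realType) n (x : R) : n%:R * x = \sum_(j < n) x.
Proof. by rewrite sumr_const card_ord mulr_natl. Qed.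

Lemma inorm_le (R : realType) m n (b : imx R m n) (r : R) : 0 <= r ->
  box_within b r -> inorm b <= n%:R * r.
Proof.
move=> r0 br; apply: bigmax_le => [|i _]; first exact: mulr_ge0.
rewrite natr_mul_sum; apply: ler_sum => j _.
by case: (br i j) => *; rewrite ge_max !ler_norml; apply/andP; split; lra.
Qed.

Lemma ifat_within (R : realType) m n (b : imx R m n) (r d : R) : 0 <= d ->
  box_within b r -> box_within (ifat b d) (r + d).
Proof. by move=> d0 br i j; case: (br i j) => *; rewrite /= !mxE; split; lra. Qed.

Lemma ifat_width (R : realType) m n (b : imx R m n) (d : R) : 0 <= d ->
  width (ifat b d) <= width b + 2 * d.
Proof.
move=> d0; have w0 := width_ge0 b; apply: width_leP => [|i j]; first by lra.
by have := entry_width b i j; rewrite /= !mxE; lra.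
Qed.

(** * Endpoints and widths of interval products *)

(** The minimum is attained at one of four endpoint products; later bounds only need its factors to
    lie in the two intervals. *)
Lemma mul_loE (R : realType) (a b c d : R) : a <= b -> c <= d ->
  exists p q, [/\ a <= p <= b, c <= q <= d & mul_lo a b c d = p * q].
Proof.
rewrite /mul_lo => ab cd.
case: (leP (a * c) (a * d)) => _; case: (leP (b * c) (b * d)) => _;
  case: leP => _.
all: by [ exists a, c; rewrite !lexx ab cd | exists a, d; rewrite !lexx ab cd
        | exists b, c; rewrite !lexx ab cd | exists b, d; rewrite !lexx ab cd].
Qed.

Lemma mul_hiE (R : realType) (a b c d : R) : a <= b -> c <= d ->
  exists p q, [/\ a <= p <= b, c <= q <= d & mul_hi a b c d = p * q].
Proof.
rewrite /mul_hi => ab cd.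
case: (leP (a * c) (a * d)) => _; case: (leP (b * c) (b * d)) => _;
  case: leP => _.
all: by [ exists a, c; rewrite !lexx ab cd | exists a, d; rewrite !lexx ab cd
        | exists b, c; rewrite !lexx ab cd | exists b, d; rewrite !lexx ab cd].
Qed.

Lemma mul_lo_le_hi (R : realType) (a b c d : R) :
  mul_lo a b c d <= mul_hi a b c d.
Proof. by rewrite /mul_lo /mul_hi !(ge_min, le_max) lexx. Qed.

Lemma ler_norm_mul (R : realType) (p q r s : R) :
  - r <= p -> p <= r -> - s <= q -> q <= s -> `|p * q| <= r * s.
Proof.
by move=> *; rewrite normrM ler_pM ?ler_norml//; apply/andP; split.
Qed.

Lemma mul_lo_ge (R : realType) (a b c d r s : R) :
  - r <= a -> a <= b -> b <= r -> - s <= c -> c <= d -> d <= s ->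
  - (r * s) <= mul_lo a b c d.
Proof.
move=> ra ab br sc cd ds.
have [p [q [/andP[ap pb] /andP[cq qd] ->]]] := mul_loE ab cd.
suff : `|p * q| <= r * s by rewrite ler_norml => /andP[].
by apply: ler_norm_mul; lra.
Qed.

Lemma mul_hi_le (R : realType) (a b c d r s : R) :
  - r <= a -> a <= b -> b <= r -> - s <= c -> c <= d -> d <= s ->
  mul_hi a b c d <= r * s.
Proof.
move=> ra ab br sc cd ds.
have [p [q [/andP[ap pb] /andP[cq qd] ->]]] := mul_hiE ab cd.
apply: le_trans (ler_norm _) _.
by apply: ler_norm_mul; lra.
Qed.

Lemma mul_width (R : realType) (a b c d r s : R) :
  - r <= a -> a <= b -> b <= r -> - s <= c -> c <= d -> d <= s ->
  mul_hi a b c d - mul_lo a b c d <= r * (d - c) + s * (b - a).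
Proof.
move=> ra ab br sc cd ds.
have [p [q [/andP[ap pb] /andP[cq qd] ->]]] := mul_hiE ab cd.
have [p' [q' [/andP[ap' pb'] /andP[cq' qd'] ->]]] := mul_loE ab cd.
(* The product rule splits the difference: [p] and [q'] are bounded by [r] and [s], the differences
   by the widths of the intervals. *)
have -> : p * q - p' * q' = p * (q - q') + q' * (p - p') by ring.
by apply: lerD; apply: le_trans (ler_norm _) _; apply: ler_norm_mul; lra.
Qed.

Lemma imul_within (R : realType) m n p (b : imx R m n) (c : imx R n p)
    (r s : R) : box_within b r -> box_within c s ->
  box_within (imul b c) (n%:R * (r * s)).
Proof.
move=> br cs i k; rewrite /= !mxE; split.
- rewrite -mulrN natr_mul_sum.
  apply: ler_sum => j _; case: (br i j) (cs j k) => ? ? ? [? ? ?].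
  exact: mul_lo_ge.
- by apply: ler_sum => j _; apply: mul_lo_le_hi.
- rewrite natr_mul_sum.
  apply: ler_sum => j _; case: (br i j) (cs j k) => ? ? ? [? ? ?].
  exact: mul_hi_le.
Qed.

Lemma imul_width (R : realType) m n p (b : imx R m n) (c : imx R n p)
    (r s : R) : 0 <= r -> 0 <= s -> box_within b r -> box_within c s ->
  width (imul b c) <= n%:R * (r * width c + s * width b).
Proof.
move=> r0 s0 br cs; apply: width_leP => [|i k].
  by rewrite mulr_ge0 ?addr_ge0 ?mulr_ge0 ?width_ge0.
rewrite /= !mxE -sumrB natr_mul_sum.
apply: ler_sum => j _; case: (br i j) (cs j k) => ? ? ? [? ? ?].
apply: le_trans (mul_width (r := r) (s := s) _ _ _ _ _ _) _ => //.
by apply: lerD; apply: ler_wpM2l => //; apply: entry_width.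
Qed.

(** * Closed form of the integral over one piece *)

Lemma Rintegral_affine (R : realType) (s x c d : R) : s < x ->
  \int[@lebesgue_measure R]_(t in `[s, x]) (c + (t - s) * d) =
  c * (x - s) + d * (x - s) ^+ 2 / 2.
Proof.
move=> sx.
pose F := fun t : R => c * (t - s) + d * (t - s) ^+ 2 / 2.
have dF : forall t : R, is_derive t (1 : R) F (c + (t - s) * d).
  move=> t; rewrite /F; apply: is_derive_eq.
  by rewrite /GRing.scale /=; field.
have cF : continuous F.
  by move=> t; apply/differentiable_continuous/derivable1_diffP; case: (dF t).
have cf : {within `[s, x], continuous (fun t => c + (t - s) * d)}.
  apply: continuous_subspaceT => t.
  apply: cvgD; first exact: cvg_cst.
  apply: cvgMl; apply: cvgB; [exact: cvg_id | exact: cvg_cst].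
rewrite /Rintegral (continuous_FTC2 sx cf (F := F)).
- by rewrite /= /F; ring.
- split.
  + by move=> t _; case: (dF t).
  + exact/cvg_at_right_filter/cF.
  + exact/cvg_at_left_filter/cF.
- by move=> t _; rewrite derive1E; case: (dF t).
Qed.


(** On the integration interval [t - pt s i] is nonnegative, so scaling preserves the endpoint order
    supplied by [box_within P r], and both bounds are integrals of affine functions. *)
Lemma E2_piece_entries (R : realType) n (M : R) (u : imx R n 1 -> imx R n 1)
    (u' : imx R n 1 -> imx R n n) (s : seq R) i (Y : imx R n 1) (x r : R) k l :
  let beta := ifat Y (M * gap s i) in
  let P := imul (u' beta) (u beta) in
  let h := x - pt s i in
  0 < h -> box_within P r ->
  lo (E2_piece M u u' s i Y x) k l =
    lo Y k l + (lo (u Y) k l * h + lo P k l * h ^+ 2 / 2) /\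
  hi (E2_piece M u u' s i Y x) k l =
    hi Y k l + (hi (u Y) k l * h + hi P k l * h ^+ 2 / 2).
Proof.
move=> beta P h; rewrite subr_gt0 => sx Pr; case: (Pr k l) => _ Plh _.
rewrite /E2_piece -/beta -/P /= !mxE.
split; congr (_ + _); rewrite -Rintegral_affine //; apply: eq_Rintegral => t;
  rewrite inE /= in_itv /= => /andP[st _]; rewrite [LHS]mxE; congr (_ + _);
  rewrite [LHS]mxE;
  have tlh : (t - pt s i) * lo P k l <= (t - pt s i) * hi P k l
    by apply: ler_wpM2l; rewrite ?subr_ge0.
- by rewrite /P /= !mxE in tlh *; exact: min_l.
- by rewrite /P /= !mxE in tlh *; exact: max_r.
Qed.

(** * Discrete Gronwall step and partition points *)

(** The growth factor is absorbed by [1 + A * h <= expR (A * h)], the source term by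
    [1 <= expR (A * (p + h))]. *)
Lemma gronwall_step (R : realType) (A B p h w : R) :
  0 <= A -> 0 <= B -> 0 <= p -> 0 <= h -> w <= B * p * expR (A * p) ->
  (1 + A * h) * w + B * h <= B * (p + h) * expR (A * (p + h)).
Proof.
move=> A0 B0 p0 h0 wle.
have Ah0 : 0 <= A * h by rewrite mulr_ge0.
have Bp0 : 0 <= B * p * expR (A * p) by rewrite !mulr_ge0 ?expR_ge0.
rewrite [B * (p + h)]mulrDr [_ * expR _]mulrDl; apply: lerD.
- apply: le_trans (ler_wpM2l _ wle) _; first by rewrite addr_ge0.
  rewrite [A * (p + h)]mulrDr expRD mulrA [leRHS]mulrC.
  exact: ler_wpM2r (expR_ge1Dx _).
- by rewrite ler_peMr ?mulr_ge0 // -expR0 ler_expR mulr_ge0 // addr_ge0.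
Qed.

Lemma pt_lt (R : realType) (a : R) (s : seq R) i :
  itv_partition 0 a s -> (i < size s)%N -> pt s i < pt s i.+1.
Proof. by case=> /pathP-/(_ 0) h _; apply: h. Qed.

Lemma pt_le_end (R : realType) (a : R) (s : seq R) i :
  itv_partition 0 a s -> (i < size s)%N -> pt s i.+1 <= a.
Proof.
move=> sa si; have := itv_partition_nth_le (m := i.+1) _ sa.
(* [pt] reads with default [0]; the index is in range, so changing the default is harmless. *)
by move=> /(_ si); rewrite (set_nth_default 0).
Qed.

(** * Estimates for a single step of the operator *)

Section Step.
Variables (R : realType) (n : nat) (K M M1 L : R).
Variables (u : imx R n 1 -> imx R n 1) (u' : imx R n 1 -> imx R n n).
Hypotheses (M0 : 0 <= M) (M10 : 0 <= M1) (L0 : 0 <= L).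
Hypothesis uM : forall b, box_within b K -> box_within (u b) M.
Hypothesis u'M1 : forall b, box_within b K -> box_within (u' b) M1.
Hypothesis u_width : forall b, box_within b K ->
  width (u b) <= inorm (u' b) * width b.
Hypothesis u'_lip : forall b, box_within b K -> width (u' b) <= L * width b.

(** [nM1] bounds the norm of the values of [u'], hence is a Lipschitz constant for [u]; [prod_lip]
    is the one that the product rule gives for u'.u. *)
Let nM1 : R := n%:R * M1.
Let prod_lip : R := n%:R * (M1 * nM1 + M * L).

Lemma u_lip b : box_within b K -> width (u b) <= nM1 * width b.
Proof.
move=> bK; apply: le_trans (u_width bK) _.
by apply: ler_wpM2r; [exact: width_ge0 | apply: inorm_le => //; exact: u'M1].
Qed.

Lemma imul_u'u_lip b : box_within b K ->
  width (imul (u' b) (u b)) <= prod_lip * width b.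
Proof.
move=> bK; apply: le_trans (imul_width M10 M0 (u'M1 bK) (uM bK)) _.
rewrite /prod_lip -mulrA; apply: ler_wpM2l => //.
rewrite mulrDl -!mulrA; apply: lerD; apply: ler_wpM2l => //.
- by rewrite mulrA; exact: u_lip.
- exact: u'_lip.
Qed.

Section OneStep.
Variables (s : seq R) (i : nat) (Y : imx R n 1) (x r : R).
Let h : R := x - pt s i.
Hypotheses (h0 : 0 < h) (hg : h <= gap s i) (g1 : gap s i <= 1).
Hypotheses (Yr : box_within Y r) (rK : r + M * gap s i <= K).

Let Mg0 : 0 <= M * gap s i.
Proof. by rewrite mulr_ge0 // (le_trans (ltW h0)). Qed.

Let YK : box_within Y K.
Proof. by apply: box_within_le Yr; rewrite (le_trans _ rK) // lerDl. Qed.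

Let beta := ifat Y (M * gap s i).

Let betaK : box_within beta K.
Proof. exact: box_within_le rK (ifat_within Mg0 Yr). Qed.

Let P_within : box_within (imul (u' beta) (u beta)) (n%:R * (M1 * M)).
Proof. exact: imul_within (u'M1 betaK) (uM betaK). Qed.

(** Steps of length at most 1 let quadratic terms be traded for linear ones. *)
Let h2 : h ^+ 2 <= h.
Proof. by rewrite expr2 ger_pMl // (le_trans hg). Qed.

(** Endpoints move by at most M h + M nM1 h^2 / 2; with h^2 <= h this gives the linear rate that is
    the denominator in the bound on a. *)
Lemma E2_piece_within :
  box_within (E2_piece M u u' s i Y x) (r + M * (1 + nM1) * h).
Proof.
move=> k l; have [-> ->] := E2_piece_entries (u := u) k l h0 P_within.
rewrite -/beta -/h; set p := imul _ _; have := P_within k l; rewrite -/p.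
have -> : n%:R * (M1 * M) = M * nM1 by rewrite /nM1; ring.
have := uM YK k l; have := Yr k l.
have q0 : 0 <= M * nM1 by rewrite !mulr_ge0.
(* Naming the product [q] makes the goals linear once [c1] and [c2] supply the signs of the products
   with [h] and [h ^+ 2]. *)
move: (M * nM1) q0 (mulrDr M 1 nM1) => q q0 -> [Y1 Y2 Y3] [U1 U2 U3] [P1 P2 P3].
have h20 := sqr_ge0 h.
have pos (y : R) : 0 <= y -> 0 <= y * h by move=> ?; rewrite mulr_ge0 // ltW.
have pos2 (y : R) : 0 <= y -> 0 <= y * h ^+ 2 by move=> ?; rewrite mulr_ge0.
have qh := ler_wpM2l q0 h2; have qh0 := pos _ q0.
split.
- have c1 : 0 <= (lo (u Y) k l + M) * h by apply: pos; lra.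
  have c2 : 0 <= (lo p k l + q) * h ^+ 2 by apply: pos2; lra.
  lra.
- have c1 : 0 <= (hi (u Y) k l - lo (u Y) k l) * h by apply: pos; lra.
  have c2 : 0 <= (hi p k l - lo p k l) * h ^+ 2 by apply: pos2; lra.
  lra.
- have c1 : 0 <= (M - hi (u Y) k l) * h by apply: pos; lra.
  have c2 : 0 <= (q - hi p k l) * h ^+ 2 by apply: pos2; lra.
  lra.
Qed.

Lemma E2_piece_width m : gap s i <= m ->
  width (E2_piece M u u' s i Y x) <=
  (1 + (nM1 + prod_lip) * h) * width Y + 2 * M * prod_lip * h * m ^+ 2.
Proof.
move=> gm.
have nM1_0 : 0 <= nM1 by rewrite mulr_ge0.
have C0 : 0 <= prod_lip by rewrite mulr_ge0 // addr_ge0 // mulr_ge0.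
have w0 := width_ge0 Y; have m20 := sqr_ge0 m.
have hge0 := ltW h0.
have g0 : 0 <= gap s i by apply: le_trans hg.
apply: width_leP => [|k l].
  have ? : 0 <= (nM1 + prod_lip) * h.
    by rewrite mulr_ge0 // addr_ge0.
  by apply: addr_ge0; apply: mulr_ge0 => //; [exact: addr_ge0 | do ?[apply: mulr_ge0 => //]].
have [-> ->] := E2_piece_entries (u := u) k l h0 P_within.
rewrite -/beta -/h.
set p := imul _ _.
have Yw := entry_width Y k l.
have Uw := le_trans (entry_width (u Y) k l) (u_lip YK).
have Pw : hi p k l - lo p k l <= prod_lip * (width Y + 2 * (M * gap s i)).
  apply: le_trans (entry_width p k l) _.
  apply: le_trans (imul_u'u_lip betaK) _.
  by apply: ler_wpM2l => //; exact: ifat_width.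
have {}Uw := ler_wpM2r hge0 Uw.
have {}Pw := ler_wpM2r (sqr_ge0 h) Pw.
(* The part of the second-order term proportional to the width of [Y] joins the growth factor. *)
have c1 : prod_lip * width Y * h ^+ 2 <= prod_lip * width Y * h.
  by apply: ler_wpM2l => //; rewrite mulr_ge0.
(* The rest is cubic in the step: one factor [h] is kept for summing over the steps, the other two
   lengths are at most [m]. *)
have c2 : M * prod_lip * (gap s i * h ^+ 2) <= M * prod_lip * (h * m ^+ 2).
  apply: ler_wpM2l; first by rewrite mulr_ge0.
  have -> : gap s i * h ^+ 2 = h * (gap s i * h) by ring.
  apply: ler_wpM2l => //; rewrite expr2.
  by apply: ler_pM => //; apply: le_trans gm.
(* The factor 1/2 from integration is given away; [c3] and [c4] pay for this slack. *)
have c3 : 0 <= prod_lip * width Y * h by do ?[apply: mulr_ge0 => //].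
have c4 : 0 <= M * prod_lip * (h * m ^+ 2) by do ?[apply: mulr_ge0 => //].
lra.
Qed.

End OneStep.

(** * Iteration along the partition *)

(** [growth] and [source] are the constants A and B of the width recurrence. *)
Let growth : R := nM1 + prod_lip.
Let source : R := 2 * M * prod_lip.

Let nM1_0 : 0 <= nM1. Proof. by rewrite mulr_ge0. Qed.

Let prod_lip0 : 0 <= prod_lip.
Proof. by rewrite mulr_ge0 // addr_ge0 // mulr_ge0. Qed.

Let growth0 : 0 <= growth. Proof. exact: addr_ge0. Qed.

Let source0 : 0 <= source. Proof. by do ?[apply: mulr_ge0 => //]. Qed.

Lemma E2_constant_ge0 (a : R) :
  0 <= a -> 0 <= source * a * expR (growth * a).
Proof. by move=> a_ge0; do 2?[apply: mulr_ge0 => //]; exact: expR_ge0. Qed.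

Section Run.
Variables (a : R) (s : seq R).
Hypotheses (sa : itv_partition 0 a s) (mesh1 : mesh s <= 1).
Hypothesis (aK : M * (1 + nM1) * a <= K).

(** The invariant carries enclosure and width together, since the width estimate requires the
    arguments of [u] and [u'] to stay in the cube. *)
Definition E2_bounded (x : R) (y : imx R n 1) : Prop :=
  box_within y (M * (1 + nM1) * x) /\
  width y <= source * mesh s ^+ 2 * x * expR (growth * x).

(** The point x ranges over the whole piece: its right end drives the induction over the nodes, a
    general x gives the final estimate. *)
Lemma E2_piece_bounded i Y x : (i < size s)%N -> pt s i < x <= pt s i.+1 ->
  E2_bounded (pt s i) Y -> E2_bounded x (E2_piece M u u' s i Y x).
Proof.
move=> si /andP[ix xi] [Yr Yw].
have p0 := pt_ge0 sa (ltnW si).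
have h0 : 0 < x - pt s i by rewrite subr_gt0.
have hg : x - pt s i <= gap s i by rewrite lerD2r.
have gm : gap s i <= mesh s := le_bigmax _ (fun j : 'I_ _ => gap s j) (Ordinal si).
have g1 := le_trans gm mesh1.
(* Fattening by M times the gap costs no more than the enclosure's growth up to the next node, which
   is at most a. *)
have rK : M * (1 + nM1) * pt s i + M * gap s i <= K.
  apply: le_trans aK; rewrite -!mulrA -mulrDr; apply: ler_wpM2l => //.
  have pa : (1 + nM1) * pt s i.+1 <= (1 + nM1) * a.
    by apply: ler_wpM2l; [rewrite addr_ge0 | exact: pt_le_end sa si].
  apply: le_trans pa.
  have : 0 <= nM1 * gap s i by rewrite mulr_ge0 // (le_trans (ltW h0)).
  rewrite /gap; lra.
split.
- have := E2_piece_within h0 hg g1 Yr rK.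
  by rewrite -mulrDr subrKC.
- apply: le_trans (E2_piece_width h0 hg g1 Yr rK gm) _.
  have := gronwall_step growth0 (mulr_ge0 source0 (sqr_ge0 (mesh s))) p0
    (ltW h0) Yw.
  by rewrite subrKC [_ * (x - _) * _]mulrAC.
Qed.

Lemma E2_node_bounded i : (i <= size s)%N ->
  E2_bounded (pt s i) (E2_node M u u' s i).
Proof.
elim: i => [_|i IH si] /=; last first.
  by apply: E2_piece_bounded (IH (ltnW si)); rewrite // (pt_lt sa si) lexx.
split=> [k l|]; last by rewrite width_ipoint mulr0 mul0r.
by rewrite /= mxE mulr0 oppr0.
Qed.

Lemma E2_width x : 0 <= x <= a ->
  width (E2 M u u' s x) <= source * a * expR (growth * a) * mesh s ^+ 2.
Proof.
move=> /andP[x0 xa]; have a0 := le_trans x0 xa; rewrite /E2.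
have m0 := sqr_ge0 (mesh s).
case: ifPn => [_|].
  by rewrite width_ipoint mulr_ge0 // E2_constant_ge0.
rewrite -ltNge => {}x0; set i := find _ s.
(* The search succeeds because a is the last point; an empty sequence would force a = 0, against 0 <
   x <= a. *)
have hs : has (fun q => x <= q) s.
  apply/hasP; exists a => //.
  case: sa => _ /eqP; case: (s) => [/= a00|q t /= <-]; last exact: mem_last.
  by move: xa; rewrite -a00 leNgt x0.
have si : (i < size s)%N by rewrite -has_find.
(* Minimality of the found index gives the strict lower bound; at index 0 it is 0 < x. *)
have ix : pt s i < x <= pt s i.+1.
  rewrite /pt /= (nth_find 0 hs) andbT.
  have := before_find (a := fun q => x <= q) (s := s) 0.
  rewrite -/i; case: (i) => [|j] bf //=.
  by rewrite ltNge bf.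
have [_ wx] := E2_piece_bounded si ix (E2_node_bounded (ltnW si)).
apply: le_trans wx _.
rewrite -mulrA [leRHS]mulrAC [source * a * _]mulrAC -[leRHS]mulrA.
apply: ler_wpM2l; first exact: mulr_ge0.
apply: ler_pM; rewrite ?expR_ge0 ?ler_expR ?ler_wpM2l //; exact: ltW.
Qed.

End Run.
End Step.

(** * Assembly of the second-order bound *)

Theorem theorem5p21 (R : realType) (n : nat) (K M M1 a : R)
    (f : 'cV[R]_n -> 'cV[R]_n)
    (u : imx R n 1 -> imx R n 1) (u' : imx R n 1 -> imx R n n)
    (hn : (1 <= n)%N)
    (hK : rational K) (hM : rational M) (hM1 : rational M1) (ha : rational a)
    (K0 : 0 < K) (M0 : 0 < M) (M10 : 0 < M1)
    (a0 : 0 < a) (a_le : a <= K / (M * (1 + n%:R * M1)))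
    (f_range : forall x, cube n 1 K x -> cube n 1 M (f x))
    (f_lip : [lipschitz f x | x in cube n 1 K])
    (hu : idom n 1 n 1 K M u) (hu' : idom n 1 n n K M1 u')
    (u_ext : interval_ext K f u) (u'_ext : interval_ext_L K f u')
    (huu' : V1 n K M M1 (u, u'))
    (u_width : forall x, boxes_in (cube n 1 K) x ->
       width (u x) <= inorm (u' x) * width x)
    (u'_lip : interval_lipschitz K u') :
  exists2 C : R, 0 <= C &
    forall Q, P1Q a Q ->
      (fwidth `[0%R, a]%classic (E2 M u u' Q) <= (C * mesh Q ^+ 2)%R%:E)%E.
Proof.
have wu b : box_within b K -> box_within (u b) M.
  by move=> /boxes_inP bK; apply/boxes_inP; case: hu => + _; apply.
have wu' b : box_within b K -> box_within (u' b) M1.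
  by move=> /boxes_inP bK; apply/boxes_inP; case: hu' => + _; apply.
have uw b : box_within b K -> width (u b) <= inorm (u' b) * width b.
  by move=> /boxes_inP; apply: u_width.
have [L L0 lipL] := u'_lip.
have uL b : box_within b K -> width (u' b) <= L * width b.
  by move=> /boxes_inP; apply: lipL.
have d0 : 0 < M * (1 + n%:R * M1).
  by rewrite mulr_gt0 // ltr_pwDl // mulr_ge0 // ltW.
have aK : M * (1 + n%:R * M1) * a <= K.
  by rewrite mulrC -ler_pdivlMr.
have bound Q x : P1Q a Q -> 0 <= x <= a -> _ :=
  fun '(And4 _ Qa _ Q1) =>
    E2_width (ltW M0) (ltW M10) L0 wu wu' uw uL Qa Q1 aK (x := x).
(* The constant is left open; the width bound fixes it as B a exp (A a), independent of the
   partition. *)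
eexists; last first.
  move=> Q PQ; apply: ge_ereal_sup => _ [x /= xa <-].
  by rewrite lee_fin; apply: bound => //; rewrite in_itv in xa.
by apply: E2_constant_ge0 => //; exact: ltW.
Qed.
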